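(* There is an absolute constant $C>0$ such that the following holds. Let $n,d\ge1$ be integers, let $r>0$, let $x\in rS^{n-1}$, and let $\nu$ be a probability measure on $rS^{n-1}$. Put $$q_i=\int|x_i-y_i|\,d\nu(y),\qquad q=(q_1,\ldots,q_n).$$ Then $$\left\|x^{\otimes d}-\int y^{\otimes d}\,d\nu(y)\right\|\le\sqrt d\,r^{d-1}\|q\|_2+C\,d\,r^{d-2}\int\|x-y\|^2\,d\nu(y).$$
   Context: $S^{n-1}=\{x\in\mathbb{R}^n:\|x\|=1\}$ is the Euclidean unit sphere. $x^{\otimes d}=x\otimes\cdots\otimes x$ ($d$ factors) is an element of the Hilbert tensor product $(\mathbb{R}^n)^{\otimes d}$, whose Hilbert norm is used on the left side; on $\mathbb{R}^n$ the norms are Euclidean. *)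

(* Defs.v *)
From HB Require Import structures.
From mathcomp Require Import all_boot all_order all_algebra.
From mathcomp Require Import all_classical all_reals all_analysis.

Set Implicit Arguments.
Unset Strict Implicit.
Unset Printing Implicit Defensive.

Import Order.TTheory GRing.Theory Num.Theory.
Import numFieldNormedType.Exports.

Local Open Scope classical_set_scope.
Local Open Scope ring_scope.

(* The library norm on ['rV[R]_n] is the sup norm, so the Euclidean norm is
   introduced separately; the two induce the same topology. *)
Definition enorm (R : realType) (n : nat) (x : 'rV[R]_n) : R :=
  Num.sqrt (\sum_(i < n) x ord0 i ^+ 2).

Definition esphere (R : realType) (n : nat) (r : R) : set 'rV[R]_n :=
  [set y | enorm y = r].

Arguments esphere : clear implicits.

Definition borel_rV (R : realType) (n : nat) :=
  g_sigma_algebraType (@open 'rV[R]_n).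

(* The d-fold Hilbert tensor power of R^n in coordinates: a tensor is the
   array of its coefficients in the orthonormal basis
   e_(k 0) (x) ... (x) e_(k (d-1)), indexed by k : {0..d-1} -> {0..n-1}. *)
Definition tensor (R : realType) (n d : nat) :=
  {ffun {ffun 'I_d -> 'I_n} -> R}.

Definition tdot (R : realType) (n d : nat) (S T : tensor R n d) : R :=
  \sum_k S k * T k.

Definition tnorm (R : realType) (n d : nat) (T : tensor R n d) : R :=
  Num.sqrt (tdot T T).

Definition tprod (R : realType) (n d : nat) (v : 'I_d -> 'rV[R]_n) :
    tensor R n d :=
  [ffun k : {ffun 'I_d -> 'I_n} => \prod_(j < d) v j ord0 (k j)].

Definition tpow (R : realType) (n d : nat) (x : 'rV[R]_n) : tensor R n d :=
  tprod (fun _ : 'I_d => x).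

Arguments tpow {R n} d x.

(* The identity characterising the Hilbert tensor inner product. *)
Lemma tdot_tprod (R : realType) (n d : nat) (u v : 'I_d -> 'rV[R]_n) :
  tdot (tprod u) (tprod v) =
  \prod_(j < d) \sum_(i < n) u j ord0 i * v j ord0 i.
Proof.
rewrite /tdot bigA_distr_bigA /=; apply: eq_bigr => k _.
by rewrite !ffunE -big_split.
Qed.

(* The integral of a tensor-valued function; the space being
   finite-dimensional, the vector-valued integral is computed
   coefficientwise. *)
Definition tintegral (R : realType) (n d : nat)
    (nu : probability (borel_rV R n) R) (D : set (borel_rV R n))
    (F : 'rV[R]_n -> tensor R n d) : tensor R n d :=
  [ffun k => \int[nu]_(y in D) F y k].

(* Main.v *)
Require Import Defs.
From HB Require Import structures.
From mathcomp Require Import all_boot all_order all_algebra.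
From mathcomp Require Import all_classical all_reals all_analysis.
From mathcomp Require Import measurable_realfun ring lra.

Set Implicit Arguments.
Unset Strict Implicit.
Unset Printing Implicit Defensive.

Import Order.TTheory GRing.Theory Num.Theory.
Import numFieldNormedType.Exports.

Local Open Scope classical_set_scope.
Local Open Scope ring_scope.

(** The estimate holds with [C = 1].

    Write [y^(x)d = x^(x)d + L (P y) + A y], where [P] is the orthogonal
    projection onto the hyperplane orthogonal to [x], [L] is the derivative of
    the d-th tensor power at [x] and [A y] is what is left.  Projecting is what
    gives the constants their order [sqrt d] and [d]:

    - the summands of [L v] are pairwise orthogonal when [v] is orthogonal to
      [x], so that [|L v| = sqrt d r^(d-1) |v|] ([tnorm_dtpow]);

    - the discarded radial part of [y - x] has length [|x - y|^2 / (2 r)],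
      because both points lie on the same sphere, and is thus of the order of
      the remainder.  All inner products between the three tensors involved are
      known in terms of [c = <x, y> / r^2], and
      [|A y|^2 = r^(2d) (2 - 2 c^d + d (1 - c^2) (1 - 2 c^(d-1)))].  Bernoulli's
      inequality bounds this by [4 d^2 r^(2d) (1 - c)^2], which is the square of
      [d r^(d-2) |x - y|^2] ([tnorm_tpow_remainder]).

    Integrating, [L (P y)] becomes [L (P m)] where [m] is the barycenter of [nu]
    minus [x], as [P x = 0]; and [|P m| <= |m| <= |q|], since each coordinate of
    [m] is the integral of [y_i - x_i] ([enorm_barycenterB_le]).  The integral
    of a tensor-valued function is never estimated directly: the difference
    [T] of the theorem is paired with itself, and Cauchy-Schwarz is applied
    under the integral ([tnorm_tintegral_tpowB]). *)

(** * An elementary polynomial inequality *)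

Lemma onemX_le (R : realDomainType) (c : R) (j : nat) :
  `|c| <= 1 -> 1 - c ^+ j <= j%:R * (1 - c).
Proof.
move=> c1; elim: j => [|j IH]; first by rewrite expr0 subrr mul0r.
have cj : c ^+ j <= 1 by rewrite (le_trans (ler_norm _))// normrX exprn_ile1.
have c1' : 0 <= 1 - c by rewrite subr_ge0 (le_trans (ler_norm _)).
have := ler_wpM2r c1' cj.
rewrite exprS -natr1; nra.
Qed.

(** The left side is the squared norm of the second-order remainder of
    [y^(x)d] at [x], for unit vectors at angle [acos c], with [d = m.+1].  It
    vanishes to second order at [c = 1]: bounding both powers of [c] from below
    by [onemX_le], the two terms of first order in [1 - c] cancel. *)
Lemma remainder_polynomial_le (R : realFieldType) (c : R) (m : nat) : `|c| <= 1 ->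
  2 - 2 * c ^+ m.+1 + m.+1%:R * (1 - c ^+ 2) * (1 - 2 * c ^+ m)
    <= 4 * m.+1%:R ^+ 2 * (1 - c) ^+ 2.
Proof.
move=> c1.
have := onemX_le m.+1 c1; have := onemX_le m c1.
move: c1; rewrite ler_norml => /andP[cN1 c1].
have m0 : 0 <= m%:R :> R by [].
rewrite -natr1.
move: (m%:R) m0 (c ^+ m) (c ^+ m.+1) => a a0 p q hp hq.
have w0 : 0 <= (a + 1) * (1 - c) * (1 + c).
  by rewrite !mulr_ge0 //; lra.
have /(ler_wpM2l w0) h : 1 - 2 * p <= - 1 + 2 * (a * (1 - c)) by lra.
have u2 : 0 <= (a + 1) * (1 - c) ^+ 2 by rewrite mulr_ge0 ?sqr_ge0//; lra.
have /(ler_wpM2l u2) h2 : 1 + 2 * a * (1 + c) <= 4 * (a + 1) by nra.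
rewrite (_ : (a + 1) * (1 - c ^+ 2) = (a + 1) * (1 - c) * (1 + c)); last by ring.
apply: le_trans (_ : 2 * ((a + 1) * (1 - c)) +
  (a + 1) * (1 - c) * (1 + c) * (- 1 + 2 * (a * (1 - c))) <= _).
  by lra.
have -> : 4 * (a + 1) ^+ 2 * (1 - c) ^+ 2 = (a + 1) * (1 - c) ^+ 2 * (4 * (a + 1)) by ring.
apply: le_trans h2.
rewrite le_eqVlt; apply/orP; left; apply/eqP; ring.
Qed.

(** * The Hilbert inner product on tensors *)

Lemma tdotC (R : realType) n d (S T : tensor R n d) : tdot S T = tdot T S.
Proof. by apply: eq_bigr => k _; rewrite mulrC. Qed.

Lemma tdotDr (R : realType) n d (S T U : tensor R n d) :
  tdot S (T + U) = tdot S T + tdot S U.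
Proof. by rewrite /tdot -big_split; apply: eq_bigr => k _; rewrite ffunE mulrDr. Qed.

Lemma tdotZr (R : realType) n d a (S T : tensor R n d) :
  tdot S (a *: T) = a * tdot S T.
Proof. by rewrite /tdot big_distrr; apply: eq_bigr => k _; rewrite ffunE /= mulrCA. Qed.

Lemma tdotNr (R : realType) n d (S T : tensor R n d) :
  tdot S (- T) = - tdot S T.
Proof. by rewrite -scaleN1r tdotZr mulN1r. Qed.

Lemma tdotBr (R : realType) n d (S T U : tensor R n d) :
  tdot S (T - U) = tdot S T - tdot S U.
Proof. by rewrite tdotDr tdotNr. Qed.

Lemma tdotBl (R : realType) n d (S T U : tensor R n d) :
  tdot (T - U) S = tdot T S - tdot U S.
Proof. by rewrite tdotC tdotBr !(tdotC S). Qed.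

Lemma tdot_sumr (R : realType) n d (I : finType) (S : tensor R n d)
    (T : I -> tensor R n d) :
  tdot S (\sum_i T i) = \sum_i tdot S (T i).
Proof.
rewrite /tdot exchange_big; apply: eq_bigr => k _.
by rewrite sum_ffunE big_distrr.
Qed.

Lemma tdot_suml (R : realType) n d (I : finType) (S : tensor R n d)
    (T : I -> tensor R n d) :
  tdot (\sum_i T i) S = \sum_i tdot (T i) S.
Proof. by rewrite tdotC tdot_sumr; apply: eq_bigr => i _; rewrite tdotC. Qed.

Lemma tdot_ge0 (R : realType) n d (T : tensor R n d) : 0 <= tdot T T.
Proof. by apply: sumr_ge0 => k _; rewrite -expr2 sqr_ge0. Qed.

Lemma tdotE (R : realType) n d (T : tensor R n d) : tdot T T = tnorm T ^+ 2.
Proof. by rewrite sqr_sqrtr// tdot_ge0. Qed.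

Lemma tdotZl (R : realType) n d a (S T : tensor R n d) :
  tdot (a *: S) T = a * tdot S T.
Proof. by rewrite tdotC tdotZr tdotC. Qed.

Lemma tnormN (R : realType) n d (T : tensor R n d) : tnorm (- T) = tnorm T.
Proof. by rewrite /tnorm tdotNr tdotC tdotNr opprK. Qed.

Lemma tdot_tnorm0 (R : realType) n d (S T : tensor R n d) :
  tnorm S = 0 -> tdot S T = 0.
Proof.
move=> S0; have /eqP := tdotE S.
rewrite S0 expr0n psumr_eq0 => [/allP Sk|k _]; last by rewrite -expr2 sqr_ge0.
apply: big1 => k _; have := Sk k (mem_index_enum k).
by rewrite /= mulf_eq0 orbb => /eqP ->; rewrite mul0r.
Qed.

(** Cauchy-Schwarz, read off from the square of [|T| S - |S| T]. *)
Lemma tdot_le_tnorm (R : realType) n d (S T : tensor R n d) :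
  tdot S T <= tnorm S * tnorm T.
Proof.
have [S0|Sn0] := eqVneq (tnorm S) 0; first by rewrite tdot_tnorm0// S0 mul0r.
have [T0|Tn0] := eqVneq (tnorm T) 0.
  by rewrite tdotC tdot_tnorm0// T0 mulr0.
have Sp : 0 < tnorm S by rewrite lt_def Sn0 sqrtr_ge0.
have Tp : 0 < tnorm T by rewrite lt_def Tn0 sqrtr_ge0.
have := tdot_ge0 (tnorm T *: S - tnorm S *: T).
rewrite tdotBl !tdotBr !tdotZl !tdotZr (tdotC T S) !tdotE.
move: (tdot S T) (tnorm S) (tnorm T) Sp Tp {Sn0 Tn0} => p a b a0 b0 h.
rewrite -(ler_pM2l (mulr_gt0 a0 b0)); lra.
Qed.

(** * The Taylor expansion of the tensor power *)

Definition slot (R : realType) n d (x v : 'rV[R]_n) (j : 'I_d) : 'I_d -> 'rV[R]_n :=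
  fun l => if l == j then v else x.

Definition edot (R : realType) n (u v : 'rV[R]_n) : R :=
  \sum_i u ord0 i * v ord0 i.

(** The derivative at [x], in the direction [v], of the d-th tensor power. *)
Definition dtpow (R : realType) n d (x v : 'rV[R]_n) : tensor R n d :=
  \sum_(j < d) tprod (slot x v j).

Lemma prod_slot (R : realType) m (F : 'I_m.+1 -> R) (j : 'I_m.+1) (a b : R) :
  F j = a -> (forall l, l != j -> F l = b) -> \prod_l F l = a * b ^+ m.
Proof.
move=> Fj Fl; rewrite (bigD1 j)//= Fj (eq_bigr (fun=> b))//.
by rewrite prodr_const cardC1 card_ord.
Qed.

Lemma tdot_tpow (R : realType) n d (x y : 'rV[R]_n) :
  tdot (tpow d x) (tpow d y) = edot x y ^+ d.
Proof. by rewrite tdot_tprod prodr_const card_ord. Qed.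

Lemma tdot_dtpow_tpow (R : realType) n m (x v y : 'rV[R]_n) :
  tdot (dtpow m.+1 x v) (tpow m.+1 y) = m.+1%:R * (edot v y * edot x y ^+ m).
Proof.
rewrite tdot_suml (eq_bigr (fun=> edot v y * edot x y ^+ m)) => [|j _].
  by rewrite sumr_const card_ord mulr_natl.
rewrite tdot_tprod (@prod_slot _ _ _ j (edot v y) (edot x y))// /slot ?eqxx//.
by move=> l /negPf ->.
Qed.

(** For [v] orthogonal to [x] the [d] summands of the derivative are pairwise
    orthogonal, since for distinct slots the inner product contains a factor
    [<x, v>].  This is the source of [sqrt d] in place of [d]. *)
Lemma tdot_dtpow (R : realType) n m (x v : 'rV[R]_n) : edot x v = 0 ->
  tdot (dtpow m.+1 x v) (dtpow m.+1 x v) =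
  m.+1%:R * (edot v v * edot x x ^+ m).
Proof.
move=> xv; rewrite tdot_suml (eq_bigr (fun=> edot v v * edot x x ^+ m)) => [|j _].
  by rewrite sumr_const card_ord mulr_natl.
rewrite tdot_sumr (bigD1 j)//= [X in _ + X]big1 => [|l lj].
  rewrite addr0 tdot_tprod (@prod_slot _ _ _ j (edot v v) (edot x x))// /slot ?eqxx//.
  by move=> k /negPf ->.
rewrite tdot_tprod (bigD1 l)//= /slot (negPf lj) eqxx.
by rewrite -[X in X * _]/(edot x v) xv mul0r.
Qed.

Lemma edotC (R : realType) n (u v : 'rV[R]_n) : edot u v = edot v u.
Proof. by apply: eq_bigr => i _; rewrite mulrC. Qed.

Lemma edotBr (R : realType) n (u v w : 'rV[R]_n) :
  edot u (v - w) = edot u v - edot u w.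
Proof. by rewrite /edot -sumrB; apply: eq_bigr => i _; rewrite !mxE mulrBr. Qed.

Lemma edotZr (R : realType) n a (u v : 'rV[R]_n) :
  edot u (a *: v) = a * edot u v.
Proof. by rewrite /edot big_distrr; apply: eq_bigr => i _; rewrite !mxE /= mulrCA. Qed.

Lemma edotDr (R : realType) n (u v w : 'rV[R]_n) :
  edot u (v + w) = edot u v + edot u w.
Proof. by rewrite /edot -big_split; apply: eq_bigr => i _; rewrite !mxE mulrDr. Qed.

Lemma edot_enorm (R : realType) n (x : 'rV[R]_n) : edot x x = enorm x ^+ 2.
Proof.
rewrite sqr_sqrtr; last by apply: sumr_ge0 => i _; rewrite sqr_ge0.
by apply: eq_bigr => i _; rewrite expr2.
Qed.

Lemma dtpow_linear (R : realType) n d (x : 'rV[R]_n) :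
  linear (dtpow d x : _ -> tensor R n d).
Proof.
move=> a v w; rewrite /dtpow scaler_sumr -big_split; apply: eq_bigr => j _.
apply/ffunP => k; rewrite !ffunE.
rewrite (bigD1 j)//= [in X in _ = X + _](bigD1 j)//= [in X in _ = _ + X](bigD1 j)//=.
rewrite /slot eqxx !mxE mulrDl.
rewrite -scalerAl; congr (_ *: (_ * _) + _ * _).
all: by apply: eq_bigr => l /negPf ->.
Qed.

(** Orthogonal projection onto the hyperplane orthogonal to [x]. *)
Definition perp_proj (R : realType) n (x y : 'rV[R]_n) : 'rV[R]_n :=
  y - (edot x y / edot x x) *: x.

Lemma perp_proj_linear (R : realType) n (x : 'rV[R]_n) : linear (perp_proj x).
Proof.
move=> a v w; rewrite /perp_proj edotDr edotZr scalerBr scalerA.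
by rewrite mulrDl scalerDl opprD addrACA mulrA.
Qed.

Section orthogonal_projection.
Variables (R : realType) (n : nat) (x y : 'rV[R]_n).
Hypothesis x0 : edot x x != 0.

Lemma edot_perp_proj : edot x (perp_proj x y) = 0.
Proof. by rewrite edotBr edotZr mulfVK ?subrr. Qed.

Lemma edot_perp_projl : edot (perp_proj x y) y = edot y y - edot x y ^+ 2 / edot x x.
Proof.
rewrite edotC edotBr edotZr (edotC y x).
by rewrite mulrAC expr2.
Qed.

Lemma edot_perp_proj2 : edot (perp_proj x y) (perp_proj x y) = edot y y - edot x y ^+ 2 / edot x x.
Proof.
rewrite -edot_perp_projl {2}/perp_proj edotBr edotZr.
by rewrite (edotC _ x) edot_perp_proj mulr0 subr0.
Qed.

End orthogonal_projection.

Lemma enorm_perp_proj_le (R : realType) n (x y : 'rV[R]_n) : edot x x != 0 ->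
  enorm (perp_proj x y) <= enorm y.
Proof.
move=> x0; rewrite -(ler_pXn2r (ltn0Sn 1)) ?nnegrE ?sqrtr_ge0// -!edot_enorm.
by rewrite edot_perp_proj2// gerBl mulr_ge0 ?sqr_ge0// invr_ge0 edot_enorm sqr_ge0.
Qed.

Lemma enormB_sqr (R : realType) n (x y : 'rV[R]_n) :
  enorm (x - y) ^+ 2 = enorm x ^+ 2 - 2 * edot x y + enorm y ^+ 2.
Proof. by rewrite -!edot_enorm edotBr !(edotC (x - y)) !edotBr (edotC y x); ring. Qed.

(** The exponent is an integer because [d - 2] is negative when [d = 1]. *)
Lemma exprz_sub2 (R : fieldType) (r : R) m : r != 0 ->
  r ^ (m.+1%:Z - 2) * r ^+ 2 = r ^+ m.+1.
Proof. by move=> r0; rewrite -[r ^+ 2]/(r ^ 2) -expfzDr// subrK. Qed.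

(** On the sphere, the radial part of [y - x] is itself of second order, so it
    may be left in the remainder: only the tangential part of [y - x] goes into
    the linear term.  All inner products among [x^(x)d], [y^(x)d] and the linear
    term are explicit in the cosine [c] of the angle, which turns the squared
    norm into the polynomial of [remainder_polynomial_le]; as
    [|x - y|^2 = 2 r^2 (1 - c)], the bound is of order [d] and not [d^2]. *)
Lemma tnorm_tpow_remainder (R : realType) n m (r : R) (x y : 'rV[R]_n) : 0 < r ->
  enorm x = r -> enorm y = r ->
  tnorm (tpow m.+1 y - tpow m.+1 x - dtpow m.+1 x (perp_proj x y)) <=
    m.+1%:R * r ^ (m.+1%:Z - 2) * enorm (x - y) ^+ 2.
Proof.
move=> r0 xr yr; have rn0 : r != 0 by rewrite gt_eqF.
have xx : edot x x = r ^+ 2 by rewrite edot_enorm xr.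
have yy : edot y y = r ^+ 2 by rewrite edot_enorm yr.
have xx0 : edot x x != 0 by rewrite xx expf_neq0.
pose c := edot x y / r ^+ 2.
have xy : edot x y = r ^+ 2 * c by rewrite mulrC divfK ?expf_neq0.
have r20 : 0 < r ^+ 2 by rewrite exprn_gt0.
(* The two bounds come from [0 <= |x - y|^2] and [0 <= |x + y|^2]; the latter
   is read in the first tensor power, which is the space itself. *)
have c1 : `|c| <= 1.
  have h1 := sqr_ge0 (enorm (x - y)); have h2 := tdot_ge0 (tpow 1 x + tpow 1 y).
  move: h1 h2; rewrite enormB_sqr tdotDr ![tdot (_ + _) _]tdotC !tdotDr !tdot_tpow !expr1.
  rewrite (edotC y x) xx yy xr yr xy => h1 h2.
  by rewrite ler_norml; apply/andP; split; rewrite -(ler_pM2l r20); lra.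
have py : edot (perp_proj x y) y = r ^+ 2 * (1 - c ^+ 2).
  by rewrite edot_perp_projl// xx yy xy; field.
have pp : edot (perp_proj x y) (perp_proj x y) = r ^+ 2 * (1 - c ^+ 2).
  by rewrite edot_perp_proj2// xx yy xy; field.
have xp := edot_perp_proj y xx0.
clearbody c.
have AA : tdot (tpow m.+1 y - tpow m.+1 x - dtpow m.+1 x (perp_proj x y))
    (tpow m.+1 y - tpow m.+1 x - dtpow m.+1 x (perp_proj x y)) =
  (r ^+ m.+1) ^+ 2 * (2 - 2 * c ^+ m.+1 + m.+1%:R * (1 - c ^+ 2) * (1 - 2 * c ^+ m)).
  rewrite !tdotBr !tdotBl ![tdot (tpow _ _) (dtpow _ _ _)]tdotC.
  rewrite !tdot_dtpow_tpow tdot_dtpow// !tdot_tpow (edotC y x).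
  rewrite (edotC (perp_proj x y) x) xp py pp xx yy xy !exprMn !(exprS _ m).
  by move: (r ^+ m) (c ^+ m) => u w; ring.
have B0 : 0 <= m.+1%:R * r ^ (m.+1%:Z - 2) * enorm (x - y) ^+ 2.
  have rz : 0 <= r ^ (m.+1%:Z - 2) by apply: exprz_ge0; exact: ltW.
  by rewrite mulr_ge0 ?sqr_ge0// mulr_ge0.
rewrite -(ler_pXn2r (ltn0Sn 1)) ?nnegrE ?sqrtr_ge0// -tdotE AA.
rewrite enormB_sqr xr yr xy.
rewrite (_ : r ^+ 2 - _ + _ = r ^+ 2 * (2 * (1 - c))); last by ring.
rewrite mulrA -(mulrA _ _ (r ^+ 2)) exprz_sub2//.
apply: le_trans (ler_wpM2l (sqr_ge0 _) (remainder_polynomial_le m c1)) _.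
by rewrite le_eqVlt; apply/orP; left; apply/eqP; ring.
Qed.

Lemma tnorm_dtpow (R : realType) n m (r : R) (x v : 'rV[R]_n) : enorm x = r ->
  edot x v = 0 ->
  tnorm (dtpow m.+1 x v) = Num.sqrt m.+1%:R * r ^+ m * enorm v.
Proof.
move=> xr xv; have r0 : 0 <= r by rewrite -xr sqrtr_ge0.
rewrite /tnorm tdot_dtpow// !edot_enorm xr -exprM mulnC exprM -exprMn.
rewrite sqrtrM// sqrtr_sqr ger0_norm ?mulr_ge0 ?exprn_ge0 ?sqrtr_ge0//; ring.
Qed.

(** * Integration over the sphere *)

Lemma measurable_coord (R : realType) n (i : 'I_n) :
  measurable_fun setT (fun y : borel_rV R n => (y : 'rV[R]_n) ord0 i).
Proof.
apply: (measurability _ (RGenOpens.measurableE R)) => _ [_ [a [b ->]] <-].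
rewrite setTI; apply: sub_sigma_algebra.
have /continuousP := @coord_continuous R 1 n ord0 i; apply.
exact: interval_open.
Qed.

Lemma measurable_enorm (R : realType) n :
  measurable_fun setT (fun y : borel_rV R n => enorm (y : 'rV[R]_n)).
Proof.
have msqrt : measurable_fun setT (@Num.sqrt R).
  apply: (@continuous_measurable_fun R (@Num.sqrt R)); exact: sqrt_continuous.
have msum : measurable_fun setT
    (fun y : borel_rV R n => \sum_(i < n) (y : 'rV[R]_n) ord0 i ^+ 2).
  by apply: measurable_sum => i; exact: measurable_funX (measurable_coord _).
exact: measurableT_comp msqrt msum.
Qed.

Lemma measurable_esphere (R : realType) n (r : R) :
  measurable (esphere R n r : set (borel_rV R n)).
Proof.
rewrite (_ : esphere R n r = (fun y : borel_rV R n => enorm (y : 'rV[R]_n)) @^-1` [set r]) //.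
by rewrite -[X in measurable X]setTI; apply: measurable_enorm.
Qed.

Lemma coord_le_enorm (R : realType) n (y : 'rV[R]_n) i : `|y ord0 i| <= enorm y.
Proof.
rewrite -sqrtr_sqr ler_wsqrtr// (bigD1 i)//= lerDl.
by apply: sumr_ge0 => j _; rewrite sqr_ge0.
Qed.

Section sphere_integral.
Variables (R : realType) (n : nat) (r : R) (nu : probability (borel_rV R n) R).
Let S : set (borel_rV R n) := esphere R n r.

(** A class of functions integrable over the sphere that is closed under
    products, which integrability itself is not; it contains every polynomial
    in the coordinates. *)
Definition mbounded (f : 'rV[R]_n -> R) :=
  measurable_fun setT (f : borel_rV R n -> R) /\
  exists M, forall y, S y -> `|f y| <= M.

Lemma mbounded_cst c : mbounded (fun=> c).
Proof. by split=> //; exists `|c|. Qed.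

Lemma mbounded_coord i : mbounded (fun y => y ord0 i).
Proof.
split; first exact: measurable_coord.
by exists r => y <-; exact: coord_le_enorm.
Qed.

Lemma mboundedD f g : mbounded f -> mbounded g -> mbounded (fun y => f y + g y).
Proof.
move=> [mf [M fM]] [mg [N gN]]; split; first exact: measurable_funD.
by exists (M + N) => y Sy; rewrite (le_trans (ler_normD _ _))// lerD ?fM ?gN.
Qed.

Lemma mboundedM f g : mbounded f -> mbounded g -> mbounded (fun y => f y * g y).
Proof.
move=> [mf [M fM]] [mg [N gN]]; split; first exact: measurable_funM.
by exists (M * N) => y Sy; rewrite normrM ler_pM ?fM ?gN.
Qed.

Lemma mbounded_sum (I : Type) (s : seq I) (F : I -> 'rV[R]_n -> R) :
  (forall i, mbounded (F i)) -> mbounded (fun y => \sum_(i <- s) F i y).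
Proof.
move=> mF; elim: s => [|i s IH].
  by under eq_fun do rewrite big_nil; exact: mbounded_cst.
by under eq_fun do rewrite big_cons; exact: mboundedD.
Qed.

Lemma mbounded_prod (I : Type) (s : seq I) (F : I -> 'rV[R]_n -> R) :
  (forall i, mbounded (F i)) -> mbounded (fun y => \prod_(i <- s) F i y).
Proof.
move=> mF; elim: s => [|i s IH].
  by under eq_fun do rewrite big_nil; exact: mbounded_cst.
by under eq_fun do rewrite big_cons; exact: mboundedM.
Qed.

Lemma mbounded_integrable f : mbounded f -> nu.-integrable S (EFin \o f).
Proof.
move=> [mf [M fM]]; apply: measurable_bounded_integrable.
- exact: measurable_esphere.
- exact: (le_lt_trans (probability_le1 nu (measurable_esphere r)) (ltry 1)).
- exact: measurable_funTS.
- exists M; split=> [|N MN y Sy]; first exact: num_real.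
  exact: le_trans (fM y Sy) (ltW MN).
Qed.

Lemma Rintegral_sum (I : Type) (s : seq I) (F : I -> 'rV[R]_n -> R) :
  (forall i, mbounded (F i)) ->
  \int[nu]_(y in S) (\sum_(i <- s) F i y) = \sum_(i <- s) \int[nu]_(y in S) F i y.
Proof.
move=> mF; have mS := @measurable_esphere R n r.
elim: s => [|i s IH].
  rewrite big_nil; under eq_Rintegral do rewrite big_nil.
  by rewrite Rintegral_cst// mul0r.
rewrite big_cons -IH -RintegralD//; last 2 first.
- exact: mbounded_integrable.
- exact: mbounded_integrable (mbounded_sum _ mF).
by under eq_Rintegral do rewrite big_cons.
Qed.

Let mS : measurable S := measurable_esphere r.

Let Int (f : 'rV[R]_n -> R) := \int[nu]_(y in S) f y.

Definition barycenter : 'rV[R]_n := \row_i Int (fun y => y ord0 i).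

Lemma mbounded_linear (g : {scalar 'rV[R]_n}) : mbounded g.
Proof.
rewrite (_ : (g : _ -> _) = fun y => \sum_i y ord0 i * g (delta_mx ord0 i)).
  apply: mbounded_sum => i.
  by apply: mboundedM; [exact: mbounded_coord|exact: mbounded_cst].
apply/funext => y; rewrite {1}(row_sum_delta y) linear_sum.
by apply: eq_bigr => i _; rewrite linearZ.
Qed.

Lemma Rintegral_linear (g : {scalar 'rV[R]_n}) :
  \int[nu]_(y in S) g y = g barycenter.
Proof.
have gE y : g y = \sum_i y ord0 i * g (delta_mx ord0 i).
  rewrite {1}(row_sum_delta y) linear_sum.
  by apply: eq_bigr => i _; rewrite linearZ.
rewrite gE; under eq_Rintegral do rewrite gE.
have mi i : mbounded (fun y => y ord0 i * g (delta_mx ord0 i)).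
  by apply: mboundedM; [exact: mbounded_coord|exact: mbounded_cst].
rewrite Rintegral_sum//; apply: eq_bigr => i _; rewrite mxE.
by rewrite RintegralZr//; exact: mbounded_integrable (mbounded_coord i).
Qed.

Lemma mbounded_enormB_sqr (x : 'rV[R]_n) : mbounded (fun y => enorm (x - y) ^+ 2).
Proof.
have -> : (fun y : 'rV[R]_n => enorm (x - y) ^+ 2) = (fun y =>
    \sum_i (x ord0 i + -1 * y ord0 i) * (x ord0 i + -1 * y ord0 i)).
  apply/funext => y; rewrite -edot_enorm; apply: eq_bigr => i _.
  by rewrite !mxE mulN1r.
apply: mbounded_sum => i.
have mi : mbounded (fun y => x ord0 i + -1 * y ord0 i).
  apply: mboundedD; first exact: mbounded_cst.
  by apply: mboundedM; [exact: mbounded_cst|exact: mbounded_coord].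
exact: mboundedM.
Qed.

Lemma mbounded_tpow d k : mbounded (fun y => tpow d y k).
Proof.
under eq_fun do rewrite ffunE.
by apply: mbounded_prod => j; exact: mbounded_coord.
Qed.

Lemma mboundedB_cst f c : mbounded f -> mbounded (fun y => f y - c).
Proof. by move=> mf; apply: mboundedD => //; exact: mbounded_cst. Qed.

Hypothesis nuS : nu S = 1%E.

Lemma RintegralB_cst f c : mbounded f ->
  \int[nu]_(y in S) (f y - c) = \int[nu]_(y in S) f y - c.
Proof.
move=> mf; rewrite RintegralB//; last 2 first.
- exact: mbounded_integrable.
- exact: mbounded_integrable (mbounded_cst c).
by rewrite Rintegral_cst// [fine _](congr1 fine nuS) mulr1.
Qed.

Lemma enorm_barycenterB_le (x : 'rV[R]_n) :
  enorm (barycenter - x) <= enorm (\row_i Int (fun y => `|x ord0 i - y ord0 i|)).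
Proof.
rewrite ler_wsqrtr//; apply: ler_sum => i _; rewrite !mxE.
rewrite -[leLHS]real_normK ?num_real// lerXn2r ?nnegrE ?Rintegral_ge0//.
rewrite -RintegralB_cst; last exact: mbounded_coord.
under [leRHS]eq_Rintegral do rewrite distrC.
apply: le_normr_Rintegral => //; apply: mbounded_integrable.
by apply: mboundedB_cst; exact: mbounded_coord.
Qed.

Lemma mbounded_tpowB d (X : tensor R n d) k :
  mbounded (fun y => (tpow d y - X) k).
Proof.
under eq_fun do rewrite ffunE [(- X) k]ffunE.
by apply: mboundedB_cst; exact: mbounded_tpow.
Qed.

Lemma mbounded_tdot_tpowB d (T X : tensor R n d) :
  mbounded (fun y => tdot T (tpow d y - X)).
Proof.
apply: mbounded_sum => k.
by apply: mboundedM; [exact: mbounded_cst|exact: mbounded_tpowB].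
Qed.

(** Pairing with a fixed tensor commutes with the integral; this replaces the
    triangle inequality for vector-valued integrals. *)
Lemma tdot_tintegralB d (T X : tensor R n d) :
  tdot T (tintegral nu S (tpow d) - X) = \int[nu]_(y in S) tdot T (tpow d y - X).
Proof.
rewrite /tdot Rintegral_sum => [|k]; last first.
  by apply: mboundedM; [exact: mbounded_cst|exact: mbounded_tpowB].
apply: eq_bigr => k _.
rewrite RintegralZl//; last exact: mbounded_integrable (mbounded_tpowB _ _).
under [in RHS]eq_Rintegral do rewrite ffunE [(- X) k]ffunE.
by rewrite RintegralB_cst ?ffunE//; exact: mbounded_tpow.
Qed.

(** With [T] the difference on the left, [|T|^2] is the integral of the pairings
    of [T] with [y^(x)d - x^(x)d].  The linear part of the expansion integrates
    to its value at the barycenter, where the first-order bound applies, and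
    the remainder is estimated pointwise. *)
Lemma tnorm_tintegral_tpowB m (x : 'rV[R]_n) : 0 < r -> enorm x = r ->
  tnorm (tintegral nu S (tpow m.+1) - tpow m.+1 x) <=
    Num.sqrt m.+1%:R * r ^+ m * enorm (barycenter - x) +
    m.+1%:R * r ^ (m.+1%:Z - 2) * \int[nu]_(y in S) enorm (x - y) ^+ 2.
Proof.
move=> r0 xr.
set T := (X in tnorm X); set N := tnorm T.
set B := m.+1%:R * _; set I := \int[nu]_(y in S) _.
have xx0 : edot x x != 0 by rewrite edot_enorm xr expf_neq0// gt_eqF.
pose g0 y := tdot T (dtpow m.+1 x (perp_proj x y)).
have g0_lin : scalar g0.
  by move=> a u v; rewrite /g0 perp_proj_linear dtpow_linear tdotDr tdotZr.
pose g : {scalar 'rV[R]_n} := HB.pack g0 (GRing.isLinear.Build _ _ _ _ g0 g0_lin).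
have gx : g x = 0.
  rewrite /g /= /g0 (_ : perp_proj x x = 0); first last.
    by rewrite /perp_proj divff// scale1r subrr.
  have := dtpow_linear m.+1 x (-1) 0 0; rewrite scaler0 addr0 scaleN1r addNr => ->.
  by rewrite -(scale0r T) tdotZr mul0r.
(* As [g x = 0], the barycenter may be replaced by its difference with [x],
   which is what [q] controls. *)
have gbary : g barycenter <= N * (Num.sqrt m.+1%:R * r ^+ m * enorm (barycenter - x)).
  rewrite -[g barycenter]subr0 -gx -linearB /=.
  apply: le_trans (tdot_le_tnorm _ _) _; rewrite ler_wpM2l ?sqrtr_ge0//.
  rewrite (tnorm_dtpow _ xr) ?edot_perp_proj// ler_wpM2l ?enorm_perp_proj_le//.
  by rewrite mulr_ge0 ?sqrtr_ge0// exprn_ge0// ltW.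
have mE := mbounded_enormB_sqr x.
have N2 : N ^+ 2 <= g barycenter + N * B * I.
  rewrite -tdotE {2}/T tdot_tintegralB -Rintegral_linear -RintegralZl//; last first.
    exact: mbounded_integrable.
  rewrite -RintegralD//; last 2 first.
  - exact: mbounded_integrable (mbounded_linear g).
  - by apply: mbounded_integrable; apply: mboundedM => //; exact: mbounded_cst.
  apply: le_Rintegral => //.
  - exact: mbounded_integrable (mbounded_tdot_tpowB _ _).
  - apply: mbounded_integrable; apply: mboundedD; first exact: mbounded_linear.
    by apply: mboundedM => //; exact: mbounded_cst.
  - move=> y Sy; rewrite -lerBlDl /= /g0 -tdotBr.
    apply: le_trans (tdot_le_tnorm _ _) _; rewrite -mulrA ler_wpM2l ?sqrtr_ge0//.
    exact: tnorm_tpow_remainder.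
have I0 : 0 <= I by apply: Rintegral_ge0 => y _; rewrite sqr_ge0.
have B0 : 0 <= B by rewrite mulr_ge0//; apply: exprz_ge0; exact: ltW.
have [->|Nn0] := eqVneq N 0.
  apply: addr_ge0; last exact: mulr_ge0.
  by rewrite !mulr_ge0 ?sqrtr_ge0// exprn_ge0// ltW.
have Np : 0 < N by rewrite lt_def Nn0 sqrtr_ge0.
by rewrite -(ler_pM2l Np) -expr2 (le_trans N2)// mulrDr lerD ?gbary ?(mulrA N B I).
Qed.

End sphere_integral.

Theorem lemma4p2 (R : realType) :
  exists C : R, 0 < C /\
    forall (n d : nat) (r : R) (x : 'rV[R]_n)
           (nu : probability (borel_rV R n) R),
      (1 <= n)%N -> (1 <= d)%N -> 0 < r ->
      esphere R n r x ->
      nu (esphere R n r) = 1%E ->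
      let q : 'rV[R]_n :=
        \row_(i < n) \int[nu]_(y in esphere R n r)
          `|x ord0 i - (y : 'rV[R]_n) ord0 i| in
      tnorm (tpow d x - tintegral nu (esphere R n r) (tpow d)) <=
        Num.sqrt d%:R * r ^+ (d - 1) * enorm q +
        C * d%:R * r ^ (d%:Z - 2) *
          \int[nu]_(y in esphere R n r) enorm (x - y) ^+ 2.
Proof.
exists 1; split=> // n [|m] r x nu _ // _ r0 xr nuS; cbv zeta.
rewrite subSS subn0 mul1r -opprB tnormN.
apply: le_trans (tnorm_tintegral_tpowB nuS m r0 xr) _.
rewrite lerD2r ler_wpM2l ?enorm_barycenterB_le//.
by rewrite mulr_ge0 ?sqrtr_ge0// exprn_ge0// ltW.
Qed.
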